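(* Let $G$ be a finite simple triangle-free graph with maximum degree $\Delta(G)\leq 4$. Then $$\alpha(G)+\frac{3}{2}\beta(G)\geq n(G),$$ with equality if and only if every connected component $C$ of $G$ is either a single vertex, or a cycle on $5$ vertices, or satisfies $n(C)=13$, $\alpha(C)=4$, and $\beta(C)=6$.
   Context: All graphs are simple, finite and undirected. $n(G)$ is the number of vertices of $G$, $\alpha(G)$ is the independence number (maximum size of a set of pairwise non-adjacent vertices), and $\beta(G)$ is the matching number (maximum number of pairwise disjoint edges). Triangle-free means $G$ contains no $K_3$ as a subgraph. *)

(* Defs.v *)
(* A finite simple graph is a symmetric irreflexive
   relation e on a finType T. *)
From mathcomp Require Import all_boot.
Set Implicit Arguments. Unset Strict Implicit. Unset Printing Implicit Defensive.

Section Graph.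
Variable T : finType.
Variable e : rel T.

Definition independent (A : {set T}) : bool :=
  [forall x in A, forall y in A, ~~ e x y].

Definition matching (M : {set {set T}}) : bool :=
  [forall m in M, exists x, exists y, e x y && (m == [set x; y])] &&
  [forall m1 in M, forall m2 in M, (m1 != m2) ==> [disjoint m1 & m2]].

Definition alpha_on (S : {set T}) : nat :=
  \max_(A : {set T} | (A \subset S) && independent A) #|A|.

Definition beta_on (S : {set T}) : nat :=
  \max_(M : {set {set T}} | [forall m in M, m \subset S] && matching M) #|M|.

Definition alpha : nat := alpha_on [set: T].
Definition beta : nat := beta_on [set: T].

Definition triangle_free : Prop :=
  forall x y z, e x y -> e y z -> e x z -> False.

Definition max_degree_le (k : nat) : Prop :=
  forall x, #|[set y | e x y]| <= k.

Definition component (x : T) : {set T} := [set y | connect e x y].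

Definition is_C5 (S : {set T}) : Prop :=
  exists f : 'I_5 -> T, injective f /\ S = [set f i | i in 'I_5] /\
    forall i j : 'I_5,
      e (f i) (f j) = ((j : nat) == (i.+1 %% 5)) || ((i : nat) == (j.+1 %% 5)).

End Graph.

(* Main.v *)
(* Induct on the number of vertices. A disconnected graph splits, and deleting a vertex v
   with beta (G - v) < beta G gains 3/2 > 1. In the remaining case every vertex of the
   connected graph G is missed by a maximum matching, so 2 beta = n - 1 by Gallai's lemma,
   and the inequality becomes 4 alpha >= n + 3. In fact 4 alpha >= n + 4 holds for every
   triangle-free graph with maximum degree 4 unless n is 0, 1, 2, 5 or 13. *)
Require Import Defs.
From mathcomp Require Import all_boot zify.
Set Implicit Arguments. Unset Strict Implicit. Unset Printing Implicit Defensive.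

(** Everything is stated for subsets [S] of one fixed vertex set, so induced subgraphs need no types
    of their own, and the inequality is doubled to stay in [nat]. The excess 4 instead of 3 makes
    the inequality strict, which settles the equality case: only the exceptional sizes survive, and
    2 is not odd. The obstacle to [4 * alpha >= n + 4] is that one new independent vertex pays for
    four deleted vertices, while a closed neighborhood may have five. For even [n] parity recovers
    the lost unit. For odd [n] one looks for a vertex of degree at most 3 or for two vertices with
    two common neighbors; if there are none, the graph is 4-regular without 4-cycles, and a sharper
    bound applies to what remains after a deletion. *)

Section AlphaBeta.
Variables (T : finType) (e : rel T).
Implicit Types (S A B X Y : {set T}) (x y z u v w : T) (M N : {set {set T}}).
Hypotheses (esym : symmetric e) (eirr : irreflexive e).

Notation a := (alpha_on e).
Notation b := (beta_on e).

(** * Neighborhoods and independence numbers of vertex sets *)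

(** The vertex [x] may lie outside [S]; this is used to count neighbors in the rest of the graph. *)
Definition nbr S x := [set y in S | e x y].

Lemma nbr_sub S x : nbr S x \subset S.
Proof. by apply/subsetP=> y; rewrite inE => /andP[]. Qed.

Lemma independentP A : reflect {in A &, forall x y, ~~ e x y} (independent e A).
Proof.
apply: (iffP forall_inP) => [H x y xA yA|H x xA].
  by move/forall_inP: (H x xA); apply.
by apply/forall_inP => y; apply: H.
Qed.

Lemma independent_alpha S A : A \subset S -> independent e A -> #|A| <= a S.
Proof.
by move=> AS iA; apply: (@leq_bigmax_cond _ _ (fun A : {set T} => #|A|)); rewrite AS.
Qed.

Lemma alpha_witness S : exists2 A : {set T}, A \subset S /\ independent e A & #|A| = a S.
Proof.
have P0 : (set0 \subset S) && independent e set0.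
  by rewrite sub0set; apply/independentP=> x y; rewrite inE.
have [|A /andP[AS iA] E] := @eq_bigmax_cond _ (fun A : {set T} => (A \subset S) && independent e A) (fun A : {set T} => #|A|).
  by apply/card_gt0P; exists set0.
by exists A.
Qed.

Lemma alpha_join S X Y : X \subset S -> Y \subset S -> [disjoint X & Y] ->
  {in X & Y, forall x y, ~~ e x y} -> a X + a Y <= a S.
Proof.
move=> XS YS dXY nXY.
have [I [IX /independentP iI] <-] := alpha_witness X.
have [J [JY /independentP iJ] <-] := alpha_witness Y.
have -> : #|I| + #|J| = #|I :|: J|.
  rewrite cardsU disjoint_setI0 ?cards0 ?subn0 //.
  exact/(disjointWl IX)/(disjointWr JY).
apply: independent_alpha.
  by rewrite subUset (subset_trans IX XS) (subset_trans JY YS).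
apply/independentP => x y /setUP[xI|xJ] /setUP[yI|yJ].
- exact: iI.
- exact: nXY (subsetP IX _ xI) (subsetP JY _ yJ).
- rewrite esym; exact: nXY (subsetP IX _ yI) (subsetP JY _ xJ).
- exact: iJ.
Qed.

Lemma alpha_sub A B : A \subset B -> a A <= a B.
Proof.
by have [I [IA iI] <-] := alpha_witness A => AB; apply: independent_alpha (subset_trans IA AB) iI.
Qed.

Lemma alpha_gt0 S : 0 < #|S| -> 0 < a S.
Proof.
case/card_gt0P=> x xS; rewrite -(cards1 x) independent_alpha ?sub1set //.
by apply/independentP=> y z /set1P-> /set1P->; rewrite eirr.
Qed.

Lemma alpha_pair S x y : x \in S -> y \in S -> x != y -> ~~ e x y -> 1 < a S.
Proof.
move=> xS yS xy nxy; have -> : 2 = #|[set x; y]| by rewrite cards2 xy.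
apply: independent_alpha; first by rewrite subUset !sub1set xS.
by apply/independentP=> p q /set2P[]-> /set2P[]->; rewrite ?eirr // esym.
Qed.

Lemma subset_of_card S k : k <= #|S| -> exists2 R : {set T}, R \subset S & #|R| = k.
Proof.
move=> kS; exists [set x in take k (enum S)].
  by apply/subsetP=> x; rewrite inE => /mem_take; rewrite mem_enum.
by rewrite cardsE (card_uniqP _) ?take_uniq ?enum_uniq // size_takel -?cardE.
Qed.

(** The closed neighborhood of [x] may have fewer than [k] vertices; others are dropped with it so
    that the size of [R] is known exactly, as the parity arguments require. *)
Lemma alpha_remove S x k : x \in S -> #|nbr S x| < k -> k <= #|S| ->
  exists R : {set T}, [/\ R \subset S, #|R| = #|S| - k & a R < a S].
Proof.
move=> xS dx kS; have [|R RS cR] := @subset_of_card (S :\: (x |: nbr S x)) (#|S| - k).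
  have := cardsID (x |: nbr S x) S; have -> : #|S :&: (x |: nbr S x)| = #|nbr S x|.+1.
    rewrite (setIidPr _) ?cardsU1 ?inE ?xS ?eirr // subUset sub1set xS; exact: nbr_sub.
  lia.
exists R; split=> //; first exact: subset_trans RS (subsetDl _ _).
have a1 : 0 < a [set x] by apply: alpha_gt0; rewrite cards1.
rewrite -addn1; apply: leq_trans (leq_add (leqnn _) a1) _.
have H y : y \in R -> (y != x) && ~~ e x y.
  by move/(subsetP RS); rewrite !inE negb_or => /andP[/andP[-> /negP N] yS]; apply/negP=> exy; apply: N; rewrite yS.
apply: alpha_join; rewrite ?sub1set //.
- exact: subset_trans RS (subsetDl _ _).
- rewrite disjoint_sym disjoints1; apply/negP=> /H; by rewrite eqxx.
- by move=> y z /H/andP[_ N] /set1P->; rewrite esym.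
Qed.

(** * Matchings and Gallai's lemma *)

(** This is literally the predicate under the maximum in [beta_on]. *)
Definition matching_on S M := [forall m in M, m \subset S] && matching e M.

Lemma matching_onP S M :
  reflect [/\ {in M, forall m : {set T}, m \subset S},
              {in M, forall m : {set T}, exists x y, e x y /\ m = [set x; y]} &
              {in M &, forall m1 m2 : {set T}, m1 != m2 -> [disjoint m1 & m2]}]
    (matching_on S M).
Proof.
apply: (iffP idP) => [/and3P[/forall_inP MS /forall_inP Me /forall_inP Md]|[MS Me Md]].
  split=> // [m /Me/existsP[x /existsP[y /andP[xy /eqP->]]]|m1 m2 M1 M2 m12]; first by exists x, y.
  by move/forall_inP: (Md _ M1) => /(_ _ M2)/implyP; apply.
apply/and3P; split; apply/forall_inP=> m mM; first exact: MS.
  by have [x [y [xy ->]]] := Me m mM; apply/existsP; exists x; apply/existsP; exists y; rewrite xy eqxx.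
by apply/forall_inP=> m' m'M; apply/implyP; apply: Md.
Qed.

Lemma matching_beta S M : matching_on S M -> #|M| <= b S.
Proof. exact: (@leq_bigmax_cond _ _ (fun M : {set {set T}} => #|M|)). Qed.

Lemma matching_on0 S : matching_on S set0.
Proof. by apply/matching_onP; split=> [m|m|m m']; rewrite inE. Qed.

Lemma beta_witness S : exists2 M : {set {set T}}, matching_on S M & #|M| = b S.
Proof.
have [|M MS E] := @eq_bigmax_cond _ (fun M : {set {set T}} => matching_on S M) (fun M : {set {set T}} => #|M|).
  by apply/card_gt0P; exists set0; apply: matching_on0.
by exists M.
Qed.

Lemma cover_mem M (m : {set T}) x : m \in M -> x \in m -> x \in cover M.
Proof. by move=> mM xm; apply/bigcupP; exists m. Qed.

Lemma cover_matching S M : matching_on S M -> cover M \subset S.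
Proof. by case/matching_onP=> MS _ _; apply/bigcupsP. Qed.

Lemma card_cover S M : matching_on S M -> #|cover M| = 2 * #|M|.
Proof.
case/matching_onP=> _ Me Md.
have /trivIsetP/eqP <- := Md.
rewrite (eq_bigr (fun _ => 2)) => [|m /Me[x [y [xy ->]]]].
  by rewrite sum_nat_const mulnC.
by rewrite cards2; case: eqP xy => [->|//]; rewrite eirr.
Qed.

Lemma double_beta S : 2 * b S <= #|S|.
Proof.
have [M MS <-] := beta_witness S.
by rewrite -(card_cover MS); apply/subset_leq_card/cover_matching.
Qed.

Lemma matching_subset S M N : N \subset M -> matching_on S M -> matching_on S N.
Proof.
move=> /subsetP NM /matching_onP[MS Me Md].
by apply/matching_onP; split=> [m /NM|m /NM|m m' /NM mM /NM]; [apply: MS|apply: Me|apply: Md].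
Qed.

Lemma matching_add S M x y : matching_on S M -> x \in S -> y \in S -> e x y ->
  x \notin cover M -> y \notin cover M ->
  matching_on S ([set x; y] |: M) /\ #|[set x; y] |: M| = #|M|.+1.
Proof.
move=> /matching_onP[MS Me Md] xS yS xy xM yM.
have xyM m : m \in M -> [disjoint [set x; y] & m].
  move=> mM; rewrite -setI_eq0; apply/eqP/setP=> z; rewrite !inE; apply/negbTE.
  by apply/negP=> /andP[/orP[]/eqP-> zm]; [case/negP: xM|case/negP: yM]; apply: cover_mem zm.
split; last first.
  rewrite cardsU1; case: (boolP (_ \in M)) => // /cover_mem H.
  by case/negP: xM; apply: H; rewrite !inE eqxx.
apply/matching_onP; split=> [m|m|m m'].
- by case/setU1P=> [->|/MS//]; rewrite subUset !sub1set xS.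
- by case/setU1P=> [->|/Me//]; exists x, y.
- case/setU1P=> [->|mM] /setU1P[->|m'M]; rewrite ?eqxx // => mm'; first exact: xyM.
    by rewrite disjoint_sym xyM.
  exact: Md.
Qed.

Lemma partner S M x : matching_on S M -> x \in cover M -> exists2 y, e x y & [set x; y] \in M.
Proof.
case/matching_onP=> _ Me _ /bigcupP[m mM xm]; have [p [q [pq E]]] := Me m mM.
move: xm mM; rewrite E => /set2P[]->; first by exists q.
by rewrite setUC; exists p; rewrite // esym.
Qed.

Definition max_matching S M := matching_on S M && (#|M| == b S).

Definition missable S v := [exists M, max_matching S M && (v \notin cover M)].

(** Gallai's relation. The disjunct [u == v] makes it reflexive even at a vertex that some maximum
    matching misses; among missable vertices it is an equivalence containing all edges. *)
Definition never_both_missed S u v :=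
  (u == v) || [forall M, max_matching S M ==> (u \in cover M) || (v \in cover M)].

Lemma edge_never_both_missed S u v : u \in S -> v \in S -> e u v -> never_both_missed S u v.
Proof.
move=> uS vS uv; apply/orP; right; apply/forallP=> M; apply/implyP=> /andP[MS /eqP cM].
apply/negPn/negP=> /norP[uM vM].
have [/matching_beta + cM'] := matching_add MS uS vS uv uM vM; rewrite cM' cM; by rewrite ltnn.
Qed.

(* If a maximum matching M misses u and v, compare it with a maximum matching N
   missing t and sharing as many edges with M as possible: exchanging an edge of N
   for an edge of M increases the overlap. *)
Lemma never_both_missed_trans S t u v : missable S t ->
  never_both_missed S u t -> never_both_missed S t v -> never_both_missed S u v.
Proof.
case/existsP=> N0 N0P /orP[/eqP->//|/forallP ut] /orP[/eqP<-|/forallP tv].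
  by apply/orP; right; apply/forallP.
apply/orP; have [|uv] := eqVneq u v; [by left | right].
apply/forallP=> M; apply/implyP=> /[dup] Mmax /andP[MS /eqP cM].
apply/negPn/negP=> /norP[uM vM].
have tM : t \in cover M by have := ut M; rewrite Mmax (negbTE uM).
pose P N := max_matching S N && (t \notin cover N).
have [N /andP[/[dup] Nmax /andP[NS /eqP cN] tN] Nopt] := @arg_maxnP _ N0 P (fun N => #|M :&: N|) N0P.
have uN : u \in cover N by have := ut N; rewrite Nmax (negbTE tN) orbF.
have vN : v \in cover N by have := tv N; rewrite Nmax (negbTE tN).
(* The two covers have equal size and [u], [v] are covered by [N] only, so at least two vertices are
   covered by [M] only, and one of them is not [t]. *)
have [x] : exists x, x \in (cover M :\: cover N) :\ t.
  apply/set0Pn; rewrite -card_gt0 lt0n; apply/negP=> /eqP c0.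
  have := cardsD1 t (cover M :\: cover N); rewrite c0.
  have : #|[set u; v]| <= #|cover N :\: cover M|.
    by apply: subset_leq_card; rewrite subUset !sub1set !inE uM vM uN.
  have := cardsID (cover M) (cover N); have := cardsID (cover N) (cover M).
  rewrite (card_cover MS) (card_cover NS) cM cN cards2 uv setIC.
  case: (_ \in _); clear; lia.
rewrite 2!inE => /andP[xt /setDP[xM xN]].
have [y xy xyM] := partner MS xM.
have [xS yS] : x \in S /\ y \in S.
  by case/matching_onP: MS => /(_ _ xyM) + _ _; rewrite subUset !sub1set => /andP.
have yN : y \in cover N.
  apply/negPn/negP=> yN; have [/matching_beta] := matching_add NS xS yS xy xN yN.
  by move=> + cN'; rewrite cN' cN ltnn.
have [z yz yzN] := partner NS yN.
have xyN : [set x; y] \notin N.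
  by apply: contra xN => /cover_mem; apply; rewrite !inE eqxx.
have yzM : [set y; z] \notin M.
  apply/negP=> yzM; case/matching_onP: MS => _ _ /(_ _ _ xyM yzM).
  have [E|_ /(_ isT)] := eqVneq; first by rewrite E yzN in xyN.
  by rewrite -setI_eq0 => /eqP/setP/(_ y); rewrite !inE eqxx orbT.
(* The edge [yz] is not in [M], where [y] is matched to [x]. The exchange still misses [t], since
   [N] covers [y] and [x] was chosen different from [t]. *)
pose N1 := N :\ [set y; z].
have N1S : matching_on S N1 by apply: matching_subset NS; apply: subD1set.
have sN1 w : w \in cover N1 -> w \in cover N.
  by case/bigcupP=> m /setD1P[_ mN] wm; apply: cover_mem wm.
have yN1 : y \notin cover N1.
  apply/negP=> /bigcupP[m /setD1P[myz mN] ym]; case/matching_onP: NS => _ _ /(_ _ _ mN yzN myz).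
  by rewrite -setI_eq0 => /eqP/setP/(_ y); rewrite !inE ym eqxx.
have xN1 : x \notin cover N1 by apply: contra (sN1 x) xN.
have [N2S cN2] := matching_add N1S xS yS xy xN1 yN1.
have PN2 : P ([set x; y] |: N1).
  apply/andP; split.
    by rewrite /max_matching N2S cN2 -cN (cardsD1 [set y; z] N) yzN add1n eqxx.
  apply/negP=> /bigcupP[m /setU1P[->|mN1] tm].
    by case/set2P: tm => E; [rewrite E eqxx in xt|rewrite E yN in tN].
  by case/negP: tN; apply: sN1; apply: cover_mem tm.
have /= := Nopt _ PN2; rewrite leqNgt => /negP; apply.
apply/proper_card/properP; split.
  apply/subsetP=> m /setIP[mM mN]; rewrite !inE mM mN andbT /=.
  by apply/orP; right; apply: contraNneq yzM => <-.
by exists [set x; y]; rewrite inE ?xyM ?setU11 // (negbTE xyN) andbF.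
Qed.

(** A cut certificate: connectedness of [S] becomes the absence of such [A], without paths inside an
    induced subgraph. *)
Definition separates S A :=
  [&& A \subset S, A != set0, A != S & [forall x in A, forall y in S :\: A, ~~ e x y]].

(** The class of [v] under [never_both_missed] has no edge leaving it, so it is all of [S]; a
    maximum matching missing [v] then misses nothing else. *)
Lemma gallai S : S != set0 -> (forall A, ~~ separates S A) ->
  {in S, forall v, missable S v} -> #|S| = (2 * b S).+1.
Proof.
case/set0Pn=> v vS conn miss.
have /existsP[M /andP[Mmax vM]] := miss v vS.
have all_v : [set w in S | never_both_missed S v w] = S.
  apply/eqP/negPn/negP=> H; have := conn [set w in S | never_both_missed S v w].
  have sub : [set w in S | never_both_missed S v w] \subset S.
    by apply/subsetP=> w; rewrite inE => /andP[].
  rewrite /separates sub H; case/and3P; split=> //.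
    by apply/set0Pn; exists v; rewrite inE vS /never_both_missed eqxx.
  apply/forall_inP=> x; rewrite inE => /andP[xS vx].
  apply/forall_inP=> y /setDP[yS]; rewrite inE yS; apply: contra => xy.
  by apply: (never_both_missed_trans (miss x xS) vx); apply: edge_never_both_missed.
have /andP[MS /eqP <-] := Mmax.
rewrite -(card_cover MS) (cardsD1 v) vS; congr _.+1; apply: eq_card => w.
apply/setD1P/idP=> [[wv]|wM]; last first.
  split; last exact: subsetP (cover_matching MS) _ wM.
  by apply: contraNneq vM => <-.
rewrite -{1}all_v inE => /andP[wS].
rewrite /never_both_missed eq_sym (negbTE wv) => /forallP/(_ M).
by rewrite Mmax (negbTE vM).
Qed.

(** * Matching numbers under deletion and splitting *)

Lemma beta_sub A S : A \subset S -> b A <= b S.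
Proof.
move=> AS; have [M /matching_onP[MA Me Md] <-] := beta_witness A; apply: matching_beta.
by apply/matching_onP; split=> // m /MA/subset_trans; apply.
Qed.

Lemma missable_beta S v : v \in S -> b S <= b (S :\ v) -> missable S v.
Proof.
move=> vS bS; have [M MS cM] := beta_witness (S :\ v).
apply/existsP; exists M; rewrite /max_matching cM eqn_leq bS beta_sub ?subD1set // !andbT.
apply/andP; split; last first.
  by apply/negP=> /(subsetP (cover_matching MS)); rewrite !inE eqxx.
case/matching_onP: MS => MS Me Md; apply/matching_onP; split=> // m /MS/subset_trans; apply.
exact: subD1set.
Qed.

Lemma beta_separates S A : A \subset S -> b A + b (S :\: A) <= b S.
Proof.
move=> AS; have [M MA <-] := beta_witness A; have [N NB <-] := beta_witness (S :\: A).
have MN m n : m \in M -> n \in N -> [disjoint m & n].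
  case/matching_onP: MA => MA _ _ /MA mA; case/matching_onP: NB => NB _ _ /NB nB.
  apply: (disjointWl mA); apply: (disjointWr nB).
  by rewrite -setI_eq0 setIDA setIC -setIDA setDv setI0.
have dMN : [disjoint M & N].
  apply/pred0P=> m /=; apply/negbTE/negP=> /andP[mM mN].
  case/matching_onP: MA => _ /(_ _ mM) [x [y [_ E]]] _.
  by have := MN m m mM mN; rewrite E -setI_eq0 setIid => /eqP/setP/(_ x); rewrite !inE eqxx.
have -> : #|M| + #|N| = #|M :|: N| by rewrite cardsU disjoint_setI0 // cards0 subn0.
apply: matching_beta.
case/matching_onP: MA => MA Me Md; case/matching_onP: NB => NB Ne Nd.
apply/matching_onP; split=> [m|m|m n].
- by case/setUP=> [/MA/subset_trans|/NB/subset_trans]; apply; rewrite ?subsetDl.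
- by case/setUP=> [/Me|/Ne].
- case/setUP=> [mM|mN] /setUP[nM|nN]; [exact: Md|by rewrite MN| |exact: Nd].
  by rewrite disjoint_sym MN.
Qed.

Lemma alpha_setD_le S A : A \subset S -> a S <= a A + a (S :\: A).
Proof.
move=> AS; have [I [IS /independentP iI] <-] := alpha_witness S.
rewrite -(cardsID A I); apply: leq_add; apply: independent_alpha; rewrite ?subsetIr ?setSD //.
  by apply/independentP=> x y /setIP[xI _] /setIP[yI _]; apply: iI.
by apply/independentP=> x y /setDP[xI _] /setDP[yI _]; apply: iI.
Qed.

Lemma beta_setD_le S A : A \subset S -> {in A & S :\: A, forall x y, ~~ e x y} ->
  b S <= b A + b (S :\: A).
Proof.
move=> AS nA; have [M /matching_onP[MS Me Md] <-] := beta_witness S.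
rewrite -(cardsID [set m : {set T} | m \subset A] M); apply: leq_add.
  apply: matching_beta; apply/matching_onP; split=> [m|m|m n].
  - by rewrite !inE => /andP[].
  - by rewrite inE => /andP[/Me].
  - by rewrite !inE => /andP[mM _] /andP[nM _]; apply: Md.
apply: matching_beta; apply/matching_onP; split=> [m|m|m n].
- rewrite !inE => /andP[mA mM]; have := MS m mM; have [x [y [xy E]]] := Me m mM.
  move: mA; rewrite E !subUset !sub1set !inE negb_and => H /andP[xS yS]; rewrite xS yS !andbT.
  case: (boolP (x \in A)) (boolP (y \in A)) => [xA|xA] [yA|yA] //; first by rewrite xA yA in H.
    by have := nA x y xA; rewrite inE yA yS xy => /(_ isT).
  by have := nA y x yA; rewrite inE xA xS esym xy => /(_ isT).
- by rewrite inE => /andP[_ /Me].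
- by rewrite !inE => /andP[_ mM] /andP[_ nM]; apply: Md.
Qed.

(** * The independence number of a triangle-free graph *)

Hypothesis tf : triangle_free e.

Lemma nbr_independent S x : independent e (nbr S x).
Proof.
apply/independentP=> y z; rewrite !inE => /andP[_ xy] /andP[_ xz].
by apply/negP=> yz; apply: (tf xy yz xz).
Qed.

Lemma deg_alpha S x : #|nbr S x| <= a S.
Proof. exact: independent_alpha (nbr_sub S x) (nbr_independent S x). Qed.

(** The Ramsey bounds rest on one dichotomy: either some neighborhood is large, and it is
    independent, or deleting a small closed neighborhood leaves enough vertices for the previous
    bound. *)
Lemma ramsey2 S : 2 < #|S| -> 1 < a S.
Proof.
move=> cS; have /card_gt0P[x xS] : 0 < #|S| by lia.
have := deg_alpha S x; case: (leqP 2 #|nbr S x|); first lia.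
move=> dx; have [||R [RS cR]] := @alpha_remove S x 2 xS; try lia.
have := @alpha_gt0 R; lia.
Qed.

Lemma ramsey3 S : 5 < #|S| -> 2 < a S.
Proof.
move=> cS; have /card_gt0P[x xS] : 0 < #|S| by lia.
have := deg_alpha S x; case: (leqP 3 #|nbr S x|); first lia.
move=> dx; have [||R [RS cR]] := @alpha_remove S x 3 xS; try lia.
have := @ramsey2 R; lia.
Qed.

(** Deleting [z] lowers the sum by its degree twice: once at [z], once spread over its neighbors. It
    serves to exclude a 3-regular graph on nine vertices. *)
Lemma handshake S : ~~ odd (\sum_(x in S) #|nbr S x|).
Proof.
move: {2}#|S| (erefl #|S|) => n; elim: n S => [|n IH] S cS.
  by rewrite (cards0_eq cS) big_set0.
have /card_gt0P[z zS] : 0 < #|S| by rewrite cS.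
have cS' : #|S :\ z| = n by move: cS; rewrite (cardsD1 z) zS => -[].
rewrite (big_setD1 z zS) /=.
have deg x : #|nbr S x| = #|nbr (S :\ z) x| + e x z.
  rewrite (cardsD1 z) inE zS addnC /=; congr (_ + _).
  by apply: eq_card => y; rewrite !inE andbA.
rewrite (eq_bigr _ (fun x _ => deg x)) big_split /= deg eirr addn0.
rewrite addnC -addnA oddD (negbTE (IH _ cS')) /=.
suff -> : \sum_(i in S :\ z) e i z = #|nbr (S :\ z) z| by rewrite addnn odd_double.
rewrite -sum1dep_card big_mkcondr /=; apply: eq_bigr => x _.
by rewrite esym; case: (e z x).
Qed.

(** The dichotomy alone would need ten vertices. On exactly nine it fails only if all degrees are 3,
    and then the degree sum 27 is odd. *)
Lemma ramsey4 S : 8 < #|S| -> 3 < a S.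
Proof.
wlog cS : S / #|S| = 9.
  move=> H cS; have [S' S'S cS'] := subset_of_card cS.
  by apply: leq_trans (alpha_sub S'S); apply: H; rewrite ?cS'.
move=> _; case: (pickP (fun x => (x \in S) && (#|nbr S x| != 3))) => [x /andP[xS dx]|reg].
  have := deg_alpha S x; case: (leqP 4 #|nbr S x|); first lia.
  move=> dx'; have [||R [RS cR]] := @alpha_remove S x 3 xS; try lia.
  have := @ramsey3 R; lia.
have := handshake S; rewrite (eq_bigr (fun _ => 3)) ?sum_nat_const ?cS //.
by move=> x xS; have := reg x; rewrite xS /= => /eqP.
Qed.

(** * Graphs without triangles and 4-cycles *)

Definition C4_free S := forall x y u v, x \in S -> y \in S -> x != y ->
  u \in S -> v \in S -> e x u -> e y u -> e x v -> e y v -> u = v.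

Lemma C4_free_sub A B : A \subset B -> C4_free B -> C4_free A.
Proof. by move=> /subsetP AB H x y u v xA yA xy uA vA; apply: H; rewrite ?AB. Qed.

Lemma two_le_nbr S x : x \in S -> #|S| = 5 -> a S <= 2 -> 2 <= #|nbr S x|.
Proof.
move=> xS cS aS; rewrite leqNgt; apply/negP => dx.
have [||R [RS cR]] := @alpha_remove S x 2 xS; try lia.
have := @ramsey2 R; lia.
Qed.

Lemma C4_free_disjoint_nbr S A x y w : C4_free S -> A \subset S ->
  x \in S -> y \in S -> x != y -> w \in S :\: A -> e x w -> e y w ->
  [disjoint nbr A x & nbr A y].
Proof.
move=> cf /subsetP AS xS yS xy /setDP[wS wA] xw yw.
rewrite -setI_eq0; apply/eqP/setP=> u; rewrite !inE.
apply/negbTE/negP=> /andP[/andP[uA xu] /andP[_ yu]].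
have uw : u = w by apply: (cf x y) => //; apply: AS.
by move: wA; rewrite -uw uA.
Qed.

(** Excluding 4-cycles matters: the Wagner graph is triangle-free on eight vertices with
    independence number 3. If all degrees are at least 3 and [v] has degree 3, the neighbors of [v]
    reach six distinct vertices among the four left. A vertex [v] of degree 2 leaves five vertices
    [Q]: either three independent ones join [v], or each neighbor of [v] sees at most one vertex of
    [Q], and both neighbors extend an independent pair of [Q]. *)
Lemma C4_free_alpha8 S : C4_free S -> #|S| = 8 -> 3 < a S.
Proof.
move=> cf cS.
have [/exists_inP[v vS dv]|/exists_inPn D] := boolP [exists x in S, #|nbr S x| <= 2]; last first.
  have /card_gt0P[v vS] : 0 < #|S| by rewrite cS.
  have := deg_alpha S v; case: (leqP 4 #|nbr S v|); first lia.
  have := D v vS; rewrite -ltnNge => dv3 dv4 _.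
  have dv : #|nbr S v| = 3 by lia.
  pose R := S :\: (v |: nbr S v).
  have cR : #|R| = 4.
    rewrite cardsD (setIidPr _) ?cardsU1 ?inE ?vS ?eirr ?cS ?dv //.
    by rewrite subUset sub1set vS nbr_sub.
  have dR x : x \in nbr S v -> 1 < #|nbr R x|.
    rewrite inE => /andP[xS vx]; have := D x xS; rewrite -ltnNge (cardsD1 v) inE vS esym vx.
    suff -> : nbr S x :\ v = nbr R x by lia.
    apply/setP=> y; rewrite !inE negb_or negb_and.
    case: (y == v) => //=; case: (y \in S) => //=; rewrite ?andbF //.
    by case vy: (e v y) => //=; apply/negP=> xy; apply: (tf vx xy vy).
  have dj x y : x \in nbr S v -> y \in nbr S v -> x != y -> [disjoint nbr R x & nbr R y].
    rewrite !inE => /andP[xS vx] /andP[yS vy] xy.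
    apply: (C4_free_disjoint_nbr (w := v) cf) => //; rewrite 1?esym //; first exact: subsetDl.
    by rewrite !inE eqxx vS.
  have /card_gt2P[x [y [z [[xN yN zN] [xy yz zx]]]]] : 2 < #|nbr S v| by rewrite dv.
  have : #|nbr R x :|: nbr R y :|: nbr R z| <= #|R|.
    by apply: subset_leq_card; rewrite !subUset !nbr_sub.
  have dxyz : [disjoint nbr R x :|: nbr R y & nbr R z].
    have xz : x != z by rewrite eq_sym.
    by rewrite -setI_eq0 setIUl !disjoint_setI0 ?setU0 // dj.
  rewrite !cardsU !disjoint_setI0 ?dj // cards0 cR.
  have := dR x xN; have := dR y yN; have := dR z zN; lia.
have [|dv2] := leqP #|nbr S v| 1.
  move=> dv1; have [||R [RS cR]] := @alpha_remove S v 2 vS; try lia.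
  have := @ramsey3 R; lia.
have /cards2P[x [y [xy N]]] : #|nbr S v| == 2 by lia.
have [xS vx] : x \in S /\ e v x by apply/andP; move/setP: N => /(_ x); rewrite !inE eqxx.
have [yS vy] : y \in S /\ e v y by apply/andP; move/setP: N => /(_ y); rewrite !inE eqxx orbT.
pose Q := S :\: (v |: nbr S v).
have cQ : #|Q| = 5.
  rewrite cardsD (setIidPr _) ?cardsU1 ?inE ?vS ?eirr ?cS ?N ?cards2 ?xy //.
  by rewrite subUset !sub1set vS -N nbr_sub.
have QS : Q \subset S by apply: subsetDl.
have [a3|aQ] := ltnP 2 (a Q).
  have := @alpha_join S [set v] Q; have := @alpha_gt0 [set v]; rewrite cards1 => /(_ isT) av.
  suff H : [disjoint [set v] & Q] /\ {in [set v] & Q, forall x y, ~~ e x y}.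
    case: H => dQ nQ /(_ _ QS dQ nQ); rewrite sub1set vS => /(_ isT); lia.
  split; first by rewrite disjoints1 !inE eqxx.
  by move=> p q /set1P ->; rewrite !inE negb_or => /andP[/andP[_ nvq] qS]; move: nvq; rewrite qS.
have xQ : x \notin Q by rewrite !inE xS vx orbT.
have yQ : y \notin Q by rewrite !inE yS vy orbT.
clearbody Q.
(* Two neighbors [p], [q] of [w] in [Q] would have disjoint neighborhoods in [Q], each of size at
   least 2 and avoiding [p] and [q]: four vertices among three. *)
have few w : w \in S -> w \notin Q -> #|nbr Q w| <= 1.
  move=> wS wQ; rewrite leqNgt; apply/negP=> /card_gt1P[p [q [+ + pq]]].
  rewrite !inE => /andP[pQ wp] /andP[qQ wq].
  have Dp : [disjoint nbr Q p & nbr Q q].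
    apply: (C4_free_disjoint_nbr (w := w) cf) => //; rewrite 1?esym //; try exact: (subsetP QS).
    by rewrite inE wQ.
  have : #|nbr Q p :|: nbr Q q| <= #|Q :\: [set p; q]|.
    apply: subset_leq_card; apply/subsetP=> r; rewrite !inE => /orP[]/andP[-> er]; rewrite ?andbT.
      apply/norP; split; apply/eqP=> E; move: er; rewrite E ?eirr //.
      by move=> pq'; apply: (tf wp pq' wq).
    apply/norP; split; apply/eqP=> E; move: er; rewrite E ?eirr //.
    by move=> pq'; apply: (tf wq pq' wp).
  rewrite cardsU disjoint_setI0 // cards0 cardsD (setIidPr _) ?subUset ?sub1set ?pQ // cards2 pq cQ.
  have := two_le_nbr pQ cQ aQ; have := two_le_nbr qQ cQ aQ; clear; lia.
pose P := Q :\: (nbr Q x :|: nbr Q y).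
have cP : 2 < #|P|.
  have := few x xS xQ; have := few y yS yQ; have := cardsID (nbr Q x :|: nbr Q y) Q.
  have := subset_leq_card (subsetIr Q (nbr Q x :|: nbr Q y)); have := cardsU (nbr Q x) (nbr Q y).
  rewrite -/P cQ; clear; lia.
have := ramsey2 cP; have := @alpha_pair [set x; y] x y; rewrite !inE !eqxx orbT xy => /(_ isT isT isT).
have nxy : ~~ e x y by apply/negP=> exy; apply: (tf vx exy vy).
move=> /(_ nxy) a1 a2; apply: leq_trans (leq_add a1 a2) _; apply: alpha_join.
- by rewrite subUset !sub1set xS.
- exact: subset_trans (subsetDl _ _) QS.
- rewrite -setI_eq0; apply/eqP/setP=> z; rewrite !inE; case: eqP => [->|_]; first by rewrite (negbTE xQ) !andbF.
  by case: eqP => [->|//]; rewrite (negbTE yQ) !andbF.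
- by move=> p q /set2P[]-> /setDP[qQ]; rewrite !in_setU ![_ \in nbr _ _]inE qQ; case/norP.
Qed.

(* The degree hypothesis (3-degeneracy) excludes 4-regular subgraphs; it is inherited
   by subsets and allows the removal of four vertices at a time. *)
Lemma C4_free_bound S : C4_free S ->
  (forall A, A \subset S -> A != set0 -> exists2 x, x \in A & #|nbr A x| <= 3) ->
  ~~ odd #|S| -> 6 <= #|S| -> #|S| + 6 <= 4 * a S.
Proof.
move: {2}#|S| (leqnn #|S|) => n; elim: n S => [|n IH] S cS cf deg ev c6; first lia.
(* By parity the base sizes are 6 and 8, which need 3 and 4 independent vertices. *)
have [c8|c8] := leqP #|S| 8.
  have := @ramsey3 S; have := @C4_free_alpha8 S cf; lia.
have [||x xS dx] := deg S; rewrite -?card_gt0 //; first lia.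
have [||R [RS cR aR]] := @alpha_remove S x 4 xS; try lia.
suff : #|R| + 6 <= 4 * a R by lia.
apply: IH; try lia; first exact: C4_free_sub RS cf.
by move=> A AR; apply: deg; apply: subset_trans RS.
Qed.

(** * Triangle-free graphs of maximum degree 4 *)

Hypothesis deg4 : max_degree_le e 4.

Lemma deg_le4 S x : #|nbr S x| <= 4.
Proof. by apply: leq_trans (deg4 x); apply: subset_leq_card; apply/subsetP=> y; rewrite !inE => /andP[]. Qed.

(* Vertices with four neighbors in A have none outside. *)
Lemma alpha_split A S : A \subset S -> {in A, forall x, 4 <= #|nbr A x|} -> a A + a (S :\: A) <= a S.
Proof.
move=> AS d4; apply: alpha_join; rewrite ?subsetDl //.
  by rewrite -setI_eq0 setIDA setIC -setIDA setDv setI0.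
move=> x y xA /setDP[_ yA]; apply/negP=> xy.
suff : 5 <= #|[set z | e x z]| by have := deg4 x; lia.
apply: leq_trans (_ : #|y |: nbr A x| <= _); first by rewrite cardsU1 inE (negbTE yA) ltnS d4.
by apply: subset_leq_card; apply/subsetP=> z; rewrite !inE => /orP[/eqP->|/andP[]].
Qed.

(** A vertex of smaller degree could be removed within a set of four, and the nine vertices left
    contain four independent ones. *)
Lemma regular13 S : #|S| = 13 -> a S <= 4 -> {in S, forall x, 4 <= #|nbr S x|}.
Proof.
move=> cS aS x xS; rewrite leqNgt; apply/negP=> dx.
have [||R [RS cR]] := @alpha_remove S x 4 xS; try lia.
have := @ramsey4 R; lia.
Qed.

(** The positive sizes up to 13 at which the Ramsey bounds, here 1, 1, 2 and 4, fall below
    [(n + 4) / 4]. *)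
Definition deficient n := n \in [:: 1; 2; 5; 13].

(* Remove a set of 5, 4 or 8 vertices containing the closed neighborhood of one vertex
   or of two vertices with two common neighbors. If the remaining set has 13 vertices and
   independence number 4, it is 4-regular, hence a union of components. In the last case
   the graph is 4-regular without 4-cycles, and the complement of a closed neighborhood
   is 3-degenerate unless the graph splits. *)
Lemma alpha_bound S : 0 < #|S| -> ~~ deficient #|S| -> #|S| + 4 <= 4 * a S.
Proof.
move: {2}#|S| (leqnn #|S|) => n; elim: n S => [|n IH] S; first lia.
have [cS _|cS] := leqP #|S| 13.
  have := @alpha_gt0 S; have := @ramsey2 S; have := @ramsey3 S; have := @ramsey4 S.
  rewrite /deficient !inE; lia.
move=> cSn _ _.
(* The deficient sizes still satisfy the bound with excess 2, and the two sides of a split add up to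
   excess 4. *)
have weak (R : {set T}) : R \subset S -> 0 < #|R| -> #|R| < #|S| -> #|R| + 2 <= 4 * a R.
  move=> RS R0 RnS; have [D|/IH] := boolP (deficient #|R|); last lia.
  move: D; rewrite /deficient !inE.
  have := @alpha_gt0 R; have := @ramsey2 R; have := @ramsey4 R; lia.
have split4 (A : {set T}) : A \subset S -> 0 < #|A| -> #|A| < #|S| -> {in A, forall x, 4 <= #|nbr A x|} -> #|S| + 4 <= 4 * a S.
  move=> AS A0 AnS d4; have := alpha_split AS d4; have := weak A AS A0 AnS.
  have := cardsD S A; rewrite (setIidPr AS) => cD.
  have := weak (S :\: A) (subsetDl _ _); lia.
(* The lower limit 7 leaves 13 as the only deficient size. *)
have step (R : {set T}) k : R \subset S -> #|R| = #|S| - k -> 7 <= #|R| < #|S| -> #|R| + 4 <= 4 * a R \/ #|S| + 4 <= 4 * a S.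
  move=> RS cR cR'; have [D|/IH] := boolP (deficient #|R|); last by left; lia.
  have cR13 : #|R| = 13 by move: D; rewrite /deficient !inE; lia.
  have [aR|aR] := leqP (a R) 4; last by left; lia.
  right; apply: (split4 R) => //; try lia; exact: regular13.
(* Despite the names, [od] is the case of even [#|S|]. Then [#|R|] is odd, so [#|R| + 4 <= 4 * a R]
   improves by one and pays for the fifth vertex. *)
have [ev|od] := boolP (odd #|S|); last first.
  have /card_gt0P[x xS] : 0 < #|S| by lia.
  have [||R [RS cR aR]] := @alpha_remove S x 5 xS; rewrite ?ltnS ?deg_le4 //; try lia.
  case: (step R 5) => //; lia.
have [/exists_inP[v vS dv]|/exists_inPn D] := boolP [exists x in S, #|nbr S x| <= 3].
  have [||R [RS cR aR]] := @alpha_remove S v 4 vS; rewrite ?ltnS //; try lia.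
  case: (step R 4) => //; lia.
have [/exists_inP[x xS /exists_inP[y yS /andP[xy cxy]]]|cf] :=
   boolP [exists x in S, exists y in S, (x != y) && (1 < #|nbr S x :&: nbr S y|)].
  have nxy : ~~ e x y.
    apply/negP=> exy; have /card_gt0P[z] : 0 < #|nbr S x :&: nbr S y| by lia.
    by rewrite !inE => /andP[/andP[_ xz] /andP[_ yz]]; apply: (tf exy yz xz).
  pose B := (x |: nbr S x) :|: (y |: nbr S y).
  have BS : B \subset S by rewrite !subUset !sub1set xS yS !nbr_sub.
  have cB : #|B| <= 8.
    have -> : B = [set x; y] :|: (nbr S x :|: nbr S y) by rewrite /B setUACA.
    have := cardsU [set x; y] (nbr S x :|: nbr S y); rewrite cards2 xy.
    have := cardsU (nbr S x) (nbr S y); have := deg_le4 S x; have := deg_le4 S y; lia.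
  have [|R RS cR] := @subset_of_card (S :\: B) (#|S| - 8).
    by rewrite cardsD (setIidPr BS); lia.
  have : 2 + a R <= a S.
    have := @alpha_pair [set x; y] x y; rewrite !inE !eqxx orbT xy => /(_ isT isT isT nxy) a1.
    apply: leq_trans (leq_add a1 (leqnn _)) _; apply: alpha_join.
    - by rewrite subUset !sub1set xS.
    - exact: subset_trans RS (subsetDl _ _).
    - apply: (disjointWr RS); rewrite -setI_eq0 setIDA setD_eq0; apply: subset_trans (subsetIl _ _) _.
      by rewrite subUset !sub1set !inE !eqxx !orbT.
    - move=> p q + /(subsetP RS); rewrite !inE => pxy /andP[+ qS].
      by rewrite qS !negb_or => /andP[/andP[_ qx] /andP[_ qy]]; case/orP: pxy => /eqP->.
  have RS' := subset_trans RS (subsetDl _ _).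
  case: (step R 8) => //; lia.
have {}cf : C4_free S.
  move=> x y u v xS yS xy uS vS xu yu xv yv; apply/eqP/negPn/negP=> uv.
  move/exists_inPn/(_ x xS)/exists_inPn/(_ y yS): cf; rewrite xy -leqNgt => /card_le1_eqP H.
  by case/eqP: uv; apply: H; rewrite !inE ?uS ?vS ?xu ?yu ?xv ?yv.
have /card_gt0P[x xS] : 0 < #|S| by lia.
have [||R [RS cR aR]] := @alpha_remove S x 5 xS; rewrite ?ltnS ?deg_le4 //; try lia.
have [/existsP[A /and3P[AR A0 /forall_inP d4]]|H] :=
  boolP [exists A : {set T}, [&& A \subset R, 0 < #|A| & [forall x in A, 4 <= #|nbr A x|]]].
  apply: (split4 A) => //; first exact: subset_trans RS.
  have := subset_leq_card AR; lia.
(* Excess 5 would suffice, but [#|R|] is even, so parity makes it 6. *)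
suff : #|R| + 6 <= 4 * a R by lia.
apply: C4_free_bound; try lia; first exact: C4_free_sub RS cf.
move=> A AR A0; move/existsPn/(_ A): H; rewrite AR card_gt0 A0 /= => /forall_inPn[z zA].
by rewrite -ltnNge; exists z.
Qed.

(** * Components attaining equality *)

(** Purely numerical, as the arithmetic delivers it; [tight_C5] recovers the pentagon. *)
Definition tight S :=
  #|S| = 1 \/ (#|S| = 5 /\ a S = 2) \/ (#|S| = 13 /\ a S = 4 /\ b S = 6).

Lemma alpha_beta_bound S : 2 * #|S| <= 2 * a S + 3 * b S /\
  (S != set0 -> (forall A, ~~ separates S A) -> 2 * a S + 3 * b S = 2 * #|S| -> tight S).
Proof.
move: {2}#|S| (leqnn #|S|) => n; elim: n S => [|n IH] S cS.
  have /eqP/cards0_eq -> : #|S| == 0 by lia.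
  by rewrite cards0 eqxx.
have [->|S0] := eqVneq S set0; first by rewrite cards0.
have [/existsP[A sA]|/existsPn conn] := boolP [exists A, separates S A].
  split; last by move=> _ /(_ A); rewrite sA.
  case/and4P: sA => AS A0 AnS /forall_inP nA.
  have aS : a A + a (S :\: A) <= a S.
    apply: alpha_join; rewrite ?subsetDl //.
      by rewrite -setI_eq0 setIDA setIC -setIDA setDv setI0.
    by move=> x y /nA/forall_inP; apply.
  have bS := beta_separates AS.
  have pA : A \proper S by rewrite properEneq AnS.
  have := cardsD S A; rewrite (setIidPr AS); have := proper_card pA; rewrite -card_gt0 in A0.
  have [] := IH A; first by have := proper_card pA; clear -cS; lia.
  move=> IA _; have [|IB _] := IH (S :\: A).
    by have := cardsD S A; rewrite (setIidPr AS); clear -cS A0; lia.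
  clear -IA IB aS bS A0; lia.
have [/exists_inP[v vS bv]|/exists_inPn bv] := boolP [exists v in S, b (S :\ v) < b S].
  have cSv := cardsD1 v S; rewrite vS in cSv.
  have [|I _] := IH (S :\ v); first by clear -cSv cS; lia.
  have := alpha_sub (subD1set S v); clear -cSv I bv; split; lia.
have cS2 : #|S| = (2 * b S).+1.
  by apply: gallai => // v vS; apply: missable_beta => //; rewrite leqNgt bv.
rewrite -card_gt0 in S0.
(* At sizes 1, 5 and 13 the Ramsey values give exactly [#|S| + 3 <= 4 * a S]; size 2 contradicts
   [cS2]. *)
have := ramsey4 (S := S); have := ramsey2 (S := S); have := alpha_gt0 S0.
have := alpha_bound S0; rewrite /tight /deficient !inE; clear -cS2; split; lia.
Qed.

(** All degrees are 2, so walking both ways from [v0] gives [v2], [v1], [v0], [v4], [v3]; the ends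
    are adjacent because neither is adjacent to [v0]. *)
Lemma tight_C5 S : #|S| = 5 -> a S = 2 -> is_C5 e S.
Proof.
move=> cS aS; have a2 : a S <= 2 by rewrite aS.
have deg x : x \in S -> #|nbr S x| == 2.
  by move=> xS; rewrite eqn_leq (two_le_nbr xS cS a2) (leq_trans (deg_alpha S x) a2).
have tri x y z : e x y -> e x z -> ~~ e y z.
  by move=> xy xz; apply/negP=> yz; apply: (tf xy yz xz).
have no3 x y z : x \in S -> y \in S -> z \in S -> x != y -> ~~ e x y -> z != x -> z != y ->
    ~~ e x z -> e y z.
  move=> xS yS zS xy nxy zx zy nxz; apply/negPn/negP=> nyz.
  have : 3 <= a S; last by rewrite aS.
  have <- : #|z |: [set x; y]| = 3 by rewrite cardsU1 !inE (negbTE zx) (negbTE zy) cards2 xy.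
  apply: independent_alpha; first by rewrite !subUset !sub1set xS yS zS.
  apply/independentP=> p q; rewrite !inE => /or3P[]/eqP-> /or3P[]/eqP->; rewrite ?eirr //; by rewrite esym.
have other x y : x \in S -> y \in S -> e x y -> exists z, [/\ z \in S, e x z & z != y].
  move=> xS yS xy; have /card_gt0P[z] : 0 < #|nbr S x :\ y|.
    by have := eqP (deg x xS); rewrite (cardsD1 y) inE yS xy /= add1n => -[->].
  by rewrite !inE => /and3P[zy zS xz]; exists z.
have /card_gt0P[v0 v0S] : 0 < #|S| by rewrite cS.
have [v1 v1S v01] : exists2 v1, v1 \in S & e v0 v1.
  have /card_gt0P[v1] : 0 < #|nbr S v0| by rewrite (eqP (deg v0 v0S)).
  by rewrite inE => /andP[]; exists v1.
have [v4 [v4S v04 v41]] := other _ _ v0S v1S v01.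
have v10 : e v1 v0 by rewrite esym.
have v40 : e v4 v0 by rewrite esym.
have [v2 [v2S v12 v20]] := other _ _ v1S v0S v10.
have [v3 [v3S v43 v30]] := other _ _ v4S v0S v40.
have neq x y : e x y -> x != y by apply: contraTneq => ->; rewrite eirr.
have n14 := tri _ _ _ v01 v04.
have n02 := tri _ _ _ v10 v12.
have n03 := tri _ _ _ v40 v43.
have v24 : v2 != v4 by apply: contraTneq v12 => ->.
have v31 : v3 != v1 by apply: contraTneq v43 => ->; rewrite esym.
have N0 : nbr S v0 = [set v1; v4].
  apply/eqP; rewrite eq_sym eqEcard (eqP (deg _ v0S)) cards2 eq_sym v41 andbT.
  by rewrite subUset !sub1set !inE v1S v4S v01.
(* If the ends met, the fifth vertex [w] would not be adjacent to [v0], hence would be a third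
   neighbor of [v2]. *)
have v23 : v2 != v3.
  apply/negP=> /eqP E; have : ~~ (S \subset [set v0; v1; v2; v4]).
    apply/negP=> /subset_leq_card; rewrite cS; apply/negP; rewrite -ltnNge.
    by rewrite -!setUA !cardsU1 cards1; do 3!case: (_ \notin _).
  case/subsetPn=> w wS; rewrite !inE !negb_or -!andbA => /and4P[w0 w1 w2 w4].
  have n0w : ~~ e v0 w.
    apply/negP=> v0w; have : w \in nbr S v0 by rewrite inE wS.
    by rewrite N0 !inE (negbTE w1) (negbTE w4).
  have v2w : e v2 w by apply: (no3 v0) => //; rewrite eq_sym.
  have : #|w |: [set v1; v4]| <= #|nbr S v2|.
    apply: subset_leq_card; rewrite !subUset !sub1set !inE wS v1S v4S v2w esym v12 /=.
    by rewrite esym E.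
  by rewrite (eqP (deg _ v2S)) cardsU1 !inE (negbTE w1) (negbTE w4) cards2 eq_sym v41.
have e23 : e v2 v3 by apply: (no3 v0) => //; rewrite eq_sym.
have n13 : ~~ e v1 v3 by apply: (tri v2); rewrite // esym.
have n24 : ~~ e v2 v4 by apply: (tri v3); rewrite // esym.
pose s := [:: v0; v1; v2; v3; v4].
have us : uniq s.
  rewrite /= !inE !negb_or (neq _ _ v01) (neq _ _ v04) (neq _ _ v12) (neq _ _ e23) v24.
  by rewrite ![v0 == _]eq_sym v20 v30 [v1 == v3]eq_sym v31 [v1 == v4]eq_sym v41 eq_sym (neq _ _ v43).
pose f (i : 'I_5) := nth v0 s i.
have finj : injective f.
  by move=> i j /eqP; rewrite nth_uniq // => /eqP/val_inj.
exists f; split=> //; split.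
  apply/eqP; rewrite eq_sym eqEcard card_imset // card_ord cS leqnn andbT.
  by apply/subsetP=> _ /imsetP[[[|[|[|[|[|i]]]]] Hi] _ ->].
case=> [[|[|[|[|[|i]]]]] Hi] // [[|[|[|[|[|j]]]]] Hj] //; rewrite /f /= ?eirr //.
all: by [|rewrite esym|apply: negbTE|rewrite esym; apply: negbTE].
Qed.

(** Together with [b S <= 2] from [double_beta] this yields [2 * a S + 3 * b S <= 2 * #|S|]. *)
Lemma is_C5_tight S : is_C5 e S -> #|S| = 5 /\ a S <= 2.
Proof.
case=> f [finj [-> fe]]; split; first by rewrite card_imset ?card_ord.
have [A [AS /independentP iA] <-] := alpha_witness [set f i | i in 'I_5].
have -> : A = f @: (f @^-1: A).
  apply/setP=> x; apply/idP/imsetP=> [xA|[i]]; last by rewrite inE => iA' ->.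
  by have /imsetP[i _ xi] := subsetP AS x xA; exists i; rewrite // inE -xi.
rewrite card_imset // -sum1_card big_mkcond /= !big_ord_recl big_ord0.
have adj (i j : 'I_5) : e (f i) (f j) -> ~~ ((i \in f @^-1: A) && (j \in f @^-1: A)).
  by move=> ij; apply/negP; rewrite !inE => /andP[iA' jA]; have := iA _ _ iA' jA; rewrite ij.
set i0 := ord0; set i1 := lift _ _; set i2 := lift _ _; set i3 := lift _ _; set i4 := lift _ _.
(* The five cycle edges forbid consecutive members; the 32 membership patterns are then checked. *)
have := adj i0 i1; rewrite fe => /(_ isT); have := adj i1 i2; rewrite fe => /(_ isT).
have := adj i2 i3; rewrite fe => /(_ isT); have := adj i3 i4; rewrite fe => /(_ isT).
have := adj i4 i0; rewrite fe => /(_ isT).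
by do 5 case: (_ \in _).
Qed.

(** * Components as connected sets *)

Lemma mem_component x y : (y \in component e x) = connect e x y.
Proof. by rewrite inE. Qed.

Lemma component_closed x : {in component e x & ~: component e x, forall y z, ~~ e y z}.
Proof.
move=> y z; rewrite !inE => xy nxz; apply: contra nxz => yz.
exact: connect_trans xy (connect1 yz).
Qed.

(** A separating [A] would be closed under adjacency in the whole graph, hence contain the
    component. *)
Lemma component_connected x A : ~~ separates (component e x) A.
Proof.
apply/negP=> /and4P[AC /set0Pn[z zA] AnC /forall_inP nA].
have csym := sym_connect_sym esym.
have clA : closed e A.
  apply: intro_closed => // y w yw yA; apply/negPn/negP=> wA.
  have wC : w \in component e x.
    have := subsetP AC y yA; rewrite !mem_component => xy; exact: connect_trans xy (connect1 yw).
  by have /forall_inP/(_ w) := nA y yA; rewrite inE wA wC yw => /(_ isT).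
case/negP: AnC; rewrite eqEsubset AC; apply/subsetP=> y.
have := subsetP AC z zA; rewrite !mem_component csym => zx xy.
by rewrite -(closed_connect clA (connect_trans zx xy)).
Qed.

End AlphaBeta.

Theorem theorem2 (T : finType) (e : rel T) :
  symmetric e -> irreflexive e -> triangle_free e -> max_degree_le e 4 ->
  (2 * #|T| <= 2 * alpha e + 3 * beta e) /\
  (2 * alpha e + 3 * beta e = 2 * #|T| <->
   forall x : T,
     let C := component e x in
     #|C| = 1 \/ is_C5 e C \/
     (#|C| = 13 /\ alpha_on e C = 4 /\ beta_on e C = 6)).
Proof.
move=> esym eirr tf deg4.
have bound (S : {set T}) : 2 * #|S| <= 2 * alpha_on e S + 3 * beta_on e S.
  by case: (alpha_beta_bound esym eirr tf deg4 S).
have csym := sym_connect_sym esym.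
rewrite -cardsT; split; first exact: bound.
split=> [eqT x C|tightC].
  have aC : alpha_on e C + alpha_on e (~: C) <= alpha e.
    apply: alpha_join => //; first by rewrite disjoints_subset setCK.
    exact: component_closed.
  have bC : beta_on e C + beta_on e (~: C) <= beta e.
    by rewrite -setTD; apply: beta_separates.
  (* The bound holds on [C] and on its complement, and both parameters are superadditive, so
     equality on the whole leaves no slack on [C]. *)
  have eqC : 2 * alpha_on e C + 3 * beta_on e C = 2 * #|C|.
    have := bound C; have := bound (~: C); have := cardsC C; rewrite cardsT in eqT.
    move: aC bC eqT; clear; lia.
  have C0 : C != set0 by apply/set0Pn; exists x; rewrite mem_component.
  have [_ /(_ C0 (component_connected esym x) eqC)] := alpha_beta_bound esym eirr tf deg4 C.
  by case=> [|[[c5 a2]|]]; [left|right; left; apply: tight_C5|right; right].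
(* Given [bound], only the upper estimate remains; the induction peels components off a union of
   components. *)
suff eqS n (S : {set T}) : #|S| <= n -> {in S, forall x, component e x \subset S} ->
    2 * alpha_on e S + 3 * beta_on e S <= 2 * #|S|.
  apply/eqP; rewrite eqn_leq bound andbT; apply: (eqS _ _ (leqnn _)) => x _; exact: subsetT.
elim: n S => [|n IH] S cS clS.
  have /eqP/cards0_eq -> : #|S| == 0 by rewrite -leqn0.
  have := double_beta eirr (set0 : {set T}); have [A [+ _] <-] := alpha_witness e (set0 : {set T}).
  by rewrite subset0 => /eqP->; rewrite cards0; clear; lia.
have [->|/set0Pn[x xS]] := eqVneq S set0; first by apply: IH => [|y]; rewrite ?cards0 ?inE.
have CS := clS x xS; set C := component e x in CS.
have xC : x \in C by rewrite mem_component.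
have IHC : 2 * alpha_on e (S :\: C) + 3 * beta_on e (S :\: C) <= 2 * #|S :\: C|.
  apply: IH => [|y /setDP[yS yC]].
    rewrite -ltnS; apply: leq_trans cS; apply: proper_card; apply/properP; split; first exact: subsetDl.
    by exists x; rewrite // inE xC.
  apply/subsetP=> z yz; rewrite inE (subsetP (clS y yS) z yz) andbT; apply: contra yC.
  by move: yz; rewrite !mem_component => yz xz; apply: connect_trans xz _; rewrite csym.
have tC : 2 * alpha_on e C + 3 * beta_on e C <= 2 * #|C|.
  have := double_beta eirr C; have [c1|[/(is_C5_tight (e := e))[c5 a2]|[-> [-> ->]]//]] := tightC x.
    have [A [AC _] <-] := alpha_witness e C; have := subset_leq_card AC.
    move: c1; rewrite -/C; clear; lia.
  move: c5 a2; rewrite -/C; clear; lia.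
have aS := alpha_setD_le e CS; have bS : beta_on e S <= beta_on e C + beta_on e (S :\: C).
  apply: beta_setD_le => // y z yC /setDP[_ zC]; apply: (component_closed yC); by rewrite inE.
have := cardsD S C; rewrite (setIidPr CS); have := subset_leq_card CS.
move: IHC tC aS bS; clear; lia.
Qed.
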